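(* Let $b\geqslant 2$ be an integer and $\beta=-b$. Every alphabet $\mathcal{A}$ of contiguous integers containing $0$ with $\#\mathcal{A}=b+1$ allows parallel addition in base $\beta$. Moreover, no alphabet of contiguous integers containing $0$ and at least one other element, with fewer than $b+1$ elements, allows parallel addition in base $\beta$.
   Context: For a complex number $\beta$ with $|\beta|>1$ and a finite set $\mathcal{A}\subset\mathbb{C}$ containing $0$, let $\mathrm{Fin}_{\mathcal{A}}(\beta)=\{\sum_{j\in I}x_j\beta^j : I\subset\mathbb{Z}\text{ finite},\ x_j\in\mathcal{A}\}$. For finite alphabets $\mathcal{A},\mathcal{B}$, a map $\varphi:\mathcal{A}^{\mathbb{Z}}\to\mathcal{B}^{\mathbb{Z}}$ is $p$-local if there are integers $r,t\geqslant 0$ with $p=r+t+1$ and a map $\Phi:\mathcal{A}^p\to\mathcal{B}$ such that for every $u=(u_j)$ and $v=\varphi(u)$ one has $v_j=\Phi(u_{j+t}\cdots u_j\cdots u_{j-r})$ for all $j\in\mathbb{Z}$. A digit set conversion in base $\beta$ from $\mathcal{A}$ to $\mathcal{B}$ (both containing $0$) is a map $\varphi:\mathcal{A}^{\mathbb{Z}}\to\mathcal{B}^{\mathbb{Z}}$ such that whenever $u$ has finitely many nonzero entries, $v=\varphi(u)$ has finitely many nonzero entries and $\sum_j v_j\beta^j=\sum_j u_j\beta^j$; it is computable in parallel if it is $p$-local for some $p$. An alphabet $\mathcal{A}$ allows parallel addition in base $\beta$ (addition in $\mathrm{Fin}_{\mathcal{A}}(\beta)$ can be performed in parallel) if there exists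 a digit set conversion in base $\beta$ from $\mathcal{A}+\mathcal{A}=\{x+y:x,y\in\mathcal{A}\}$ to $\mathcal{A}$ computable in parallel. *)

(* Defs.v *)
From HB Require Import structures.
From mathcomp Require Import all_boot all_order all_algebra.
From mathcomp Require Import finmap.
From mathcomp Require Import all_classical all_reals.
From mathcomp Require Import complex.

Set Implicit Arguments.
Unset Strict Implicit.
Unset Printing Implicit Defensive.

Import Order.TTheory GRing.Theory Num.Theory.

Local Open Scope classical_set_scope.
Local Open Scope ring_scope.

(* An alphabet is a finite set [A : {fset C}], seen as a type of digits, and a
   bi-infinite word over it is a function [int -> A]. *)

Section Numeration.
Variable C : fieldType.
Implicit Types (beta : C) (A B : {fset C}).

Definition finite_word A (u : int -> A) : Prop :=
  finite_set [set j : int | val (u j) != 0].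

(* The sum over all of [int] is the library's sum over the finite support. *)
Definition word_value beta A (u : int -> A) : C :=
  \sum_(j \in [set: int]) val (u j) * beta ^ j.

(* The window is read as u_(j+t) ... u_j ... u_(j-r), from left to right. *)
Definition p_local A B (p : nat) (phi : (int -> A) -> (int -> B)) : Prop :=
  exists r t : nat, p = (r + t + 1)%N /\
    exists Phi : p.-tuple A -> B, forall (u : int -> A) (j : int),
      phi u j = Phi [tuple u (j + t%:Z - i%:Z) | i < p].

Definition digit_set_conversion beta A B
    (phi : (int -> A) -> (int -> B)) : Prop :=
  forall u : int -> A, finite_word u ->
    finite_word (phi u) /\ word_value beta (phi u) = word_value beta u.

Definition sum_alphabet A : {fset C} := [fset (x + y)%R | x in A, y in A]%fset.

Definition allows_parallel_addition beta A : Prop :=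
  exists phi : (int -> sum_alphabet A) -> (int -> A),
    digit_set_conversion beta phi /\ exists p : nat, p_local p phi.

Definition contiguous_integers A : Prop :=
  exists m n : int, forall x : C,
    x \in A <-> exists k : int, m <= k <= n /\ x = k%:~R.

End Numeration.

(* Main.v *)
Require Import Defs.
From HB Require Import structures.
From mathcomp Require Import all_boot all_order all_algebra.
From mathcomp Require Import finmap.
From mathcomp Require Import all_classical all_reals.
From mathcomp Require Import complex.
From mathcomp Require Import zify ring.

(* Write m for the least digit, so that the greatest one is m + b.  Since
   beta + b = 0, the word with digits z_j = u_j - b q_j - q_(j-1) has the same
   value as u for all finitely supported carries q.  With
   u_j = m + b k_j + s_j and 0 <= s_j < b, the choice q_j = k_j - [s_j < k_(j-1)]
   brings every z_j into [m, m + b] when m > - b: the incoming carry q_(j-1) is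
   k_(j-1) or k_(j-1) - 1, and lowering q_j pays for it exactly when s_j cannot.
   The case m = - b follows by negation.
   Conversely, a local conversion sends a long block of a digit x to a block of
   a digit y with y = x modulo beta - 1 = - (b + 1).  If m .. n has at most b
   digits, then n + 1 (if n > 0) or m - 1 (if m < 0) is a sum of two digits, and
   no digit is congruent to it modulo b + 1. *)

Set Implicit Arguments.
Unset Strict Implicit.
Unset Printing Implicit Defensive.

Import Order.TTheory GRing.Theory Num.Theory.
Local Open Scope ring_scope.

(** * Sums over infinite index sets *)

Section FinitelySupportedSums.
Local Open Scope classical_set_scope.

(** All three sums can be taken over the union of the two supports. Finiteness matters: a sum with
    infinite support is 0 by convention, which breaks additivity. *)
Lemma fsumT_split (T : choiceType) (V : nmodType) (F G : T -> V) :
  finite_set [set j | F j != 0] -> finite_set [set j | G j != 0] ->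
  \sum_(j \in [set: T]) (F j + G j) =
  \sum_(j \in [set: T]) F j + \sum_(j \in [set: T]) G j.
Proof.
move=> finF finG.
have finFG : finite_set ([set j | F j != 0] `|` [set j | G j != 0]).
  by rewrite finite_setU.
set X := fset_set ([set j | F j != 0] `|` [set j | G j != 0]).
have notX j : j \notin X -> F j = 0 /\ G j = 0.
  rewrite in_fset_set // => /negP jX; split; apply/eqP; apply: contra_notT jX.
    by move=> ?; rewrite inE; left.
  by move=> ?; rewrite inE; right.
rewrite !(fsbigTE X) ?big_split // => j /notX [Fj Gj] //.
by rewrite Fj Gj addr0.
Qed.

Lemma fsumT_shift (V : nmodType) (F : int -> V) (i : int) :
  \sum_(j \in [set: int]) F (j + i) = \sum_(j \in [set: int]) F j.
Proof.
rewrite [RHS](@reindex_fsbigT _ _ _ _ _ (fun j : int => j + i)) //.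
by exists (fun j => j - i) => j; rewrite (addrK, subrK).
Qed.

Lemma finite_set_shift (P : int -> bool) (i : int) :
  finite_set [set j | P j] -> finite_set [set j | P (j + i)].
Proof.
move=> finP; apply: (@finite_preimage _ _ [set j | P j] (fun j => j + i)) => //.
by move=> j k _ _ /addIr.
Qed.

Lemma fsumT_intr (T : choiceType) (S : pzRingType) (F : T -> S) :
  (forall j, exists k : int, F j = k%:~R) ->
  exists k : int, \sum_(j \in [set: T]) F j = k%:~R.
Proof.
move=> intF; elim/big_ind: _ => [|_ _ [k ->] [l ->]|j _]; last exact: intF.
  by exists 0.
by exists (k + l); rewrite rmorphD.
Qed.

End FinitelySupportedSums.

(** * Choice of the carries *)

Lemma carry_exists_gt (b m : int) : 2 <= b -> - b < m <= 0 ->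
  exists q : int -> int -> int, q 0 0 = 0 /\
    forall x y w, m + m <= x <= m + b + (m + b) ->
      m + m <= y <= m + b + (m + b) -> m + m <= w <= m + b + (m + b) ->
      m <= x - b * q x y - q y w <= m + b.
Proof.
move=> b2 mb.
pose k (x : int) := ((x - m) %/ b)%Z; pose s (x : int) := ((x - m) %% b)%Z.
have b0 : b != 0 by lia.
have ksE x : x = m + b * k x + s x.
  by rewrite /k /s; have := divz_eq (x - m) b; lia.
have s_bound x : 0 <= s x < b.
  have := modz_ge0 (x - m) b0; have := ltz_mod (x - m) b0; rewrite -/(s x); lia.
(* Here [x - m] lies in [m, m + 2b]. Quotient 2 forces [x - m = 2b], hence [m = 0] and remainder 0;
   quotient -1 has remainder [x - m + b >= m + b], positive because [m > - b]. *)
have k_bound (x : int) : m + m <= x <= m + b + (m + b) ->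
    [/\ -1 <= k x <= 2, (k x = 2 -> m = 0 /\ s x = 0) & (k x = -1 -> 0 < s x /\ m < 0)].
  move=> x_bound; move: (ksE x) (s_bound x) => xE sx; split; nia.
exists (fun x y : int => k x - (s x < k y)%R%:Z); split.
  have := ksE 0; have := s_bound 0 => s0 E0.
  have -> : k 0 = 0 by nia.
  lia.
move=> x y w /k_bound[kx1 kx2 kx3] /k_bound[ky1 ky2 ky3] /k_bound[kw1 kw2 kw3].
have := ksE x; have := s_bound x; have := s_bound y.
move: (s x) (s y) (k x) (k y) (k w) kx1 kx2 kx3 ky1 ky2 ky3 kw1 kw2 kw3.
move=> sx sy kx ky kw *.
have -> : x - b * (kx - (sx < ky)%R%:Z) = m + sx + b * (sx < ky)%R%:Z by lia.
(* The tight case is [ky = -1] with [sx = b - 1], where a further + 1 from [sy < kw] would overflow.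
   But then [m < 0] and [sy > 0], so [kw <= 1 <= sy]. *)
by case: (ltP sx ky); case: (ltP sy kw) => /=; lia.
Qed.

Lemma carry_exists (b m : int) : 2 <= b -> - b <= m <= 0 ->
  exists q : int -> int -> int, q 0 0 = 0 /\
    forall x y w, m + m <= x <= m + b + (m + b) ->
      m + m <= y <= m + b + (m + b) -> m + m <= w <= m + b + (m + b) ->
      m <= x - b * q x y - q y w <= m + b.
Proof.
move=> b2 mb; have [mE|m_neq] := eqVneq m (- b); last first.
  by apply: carry_exists_gt => //; lia.
have [|q [q0 qP]] := carry_exists_gt (m := 0) b2; first lia.
exists (fun x y => - q (- x) (- y)); split; first by rewrite oppr0 q0.
move=> x y w Hx Hy Hw.
have : 0 <= - x - b * q (- x) (- y) - q (- y) (- w) <= 0 + b by apply: qP; lia.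
by rewrite mE; move: (q (- x) (- y)) (q (- y) (- w)) => q1 q2; lia.
Qed.

(** * Alphabets of contiguous integers *)

Lemma contiguous_zeroP (C : numDomainType) (A : {fset C}) (m n : int) :
  (forall x : C, x \in A <-> exists k : int, m <= k <= n /\ x = k%:~R) ->
  0 \in A -> m <= 0 <= n.
Proof.
by move=> AE /AE[k [kmn /esym/eqP]]; rewrite intr_eq0 => /eqP k0; rewrite -k0.
Qed.

Lemma contiguous_card (C : numDomainType) (A : {fset C}) (m n : int) :
  (forall x : C, x \in A <-> exists k : int, m <= k <= n /\ x = k%:~R) ->
  0 \in A -> (#|` A|%fset : int) = n - m + 1.
Proof.
move=> AE /(contiguous_zeroP AE) mn0.
pose s := [seq (m + i%:Z)%:~R : C | i <- iota 0 `|n - m + 1|].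
have -> : A = [fset x in s]%fset.
  apply/fsetP => x; rewrite !inE; apply/idP/mapP.
    move=> /AE[k [kmn ->]]; exists `|k - m|%N.
      by rewrite mem_iota; lia.
    by congr (_%:~R); lia.
  move=> [l]; rewrite mem_iota => l_lt ->; apply/AE; exists (m + l%:Z).
  by split=> //; lia.
rewrite card_fseq undup_id ?size_map ?size_iota; first by lia.
rewrite map_inj_uniq ?iota_uniq // => i j /intr_inj; lia.
Qed.

(** * Sufficiency of b + 1 digits *)

Lemma parallel_addition_exists (C : numFieldType) (b : nat) (A : {fset C}) :
  (2 <= b)%N -> contiguous_integers A -> 0 \in A ->
  #|` A|%fset = (b + 1)%N -> allows_parallel_addition (- b%:R : C) A.
Proof.
move=> b2 [m [n AE]] A0 cardA.
have := contiguous_card AE A0; rewrite cardA => nE.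
have {nE} nE : n = m + b by lia.
have mn0 := contiguous_zeroP AE A0; subst n.
have [||q [q0 qP]] := @carry_exists b m; [by lia | by lia |].
have /choice[d dP] (x : sum_alphabet A) :
    exists k : int, m + m <= k <= m + b + (m + b) /\ val x = k%:~R.
  have /imfset2P[y /= /AE[k [kP ->]] [z /= /AE[l [lP ->]] xE]] := valP x.
  by exists (k + l); rewrite xE rmorphD; split=> //; lia.
(* Outside the digit range [e] may take any value; the bound [qP] keeps its argument inside. *)
have /choice[e eP] (k : int) : exists y : A, m <= k <= m + b -> val y = k%:~R.
  have [kP|_] := boolP (m <= k <= m + b); last by exists [` A0]%fset.
  have kA : k%:~R \in A by apply/AE; exists k.
  by exists [` kA]%fset.
have dB x := (dP x).1.
(* With t = 0 and r = 2 the window reads u_j, u_(j-1), u_(j-2): the new digit involves two carries,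
   each depending on two consecutive digits. *)
pose Phi (w : 3.-tuple (sum_alphabet A)) : A :=
  let c i := d (tnth w i) in
  e (c 0 - b%:Z * q (c 0) (c 1) - q (c 1) (c 2%:R)).
pose phi (u : int -> sum_alphabet A) j :=
  Phi [tuple u (j + 0%:Z - i%:Z) | i < 3].
exists phi; split; last by exists 3%N, 2%N, 0%N; split=> //; exists Phi.
move=> u finu.
pose c j := d (u j); pose Q j := q (c j) (c (j - 1)).
have phiE j : val (phi u j) = (c j - b%:Z * Q j - Q (j - 1))%:~R.
  rewrite /phi /Phi !tnth_mktuple /= addr0 subr0 eP; last first.
    exact: (qP _ _ _ (dB _) (dB _) (dB _)).
  by rewrite /Q /c -!addrA -opprD.
have uE j : val (u j) = (c j)%:~R by have [] := dP (u j).
have finc : finite_set [set j | c j != 0].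
  by apply: sub_finite_set finu => j /=; rewrite uE intr_eq0.
have finc1 i : finite_set [set j | c (j + i) != 0].
  exact: finite_set_shift finc.
(* Since [q 0 0 = 0], a carry vanishes wherever two consecutive digits do. *)
have finQ : finite_set [set j | Q j != 0].
  apply: (@sub_finite_set _ _ ([set j | c j != 0] `|` [set j | c (j - 1) != 0])%classic).
    move=> j /=; apply: contra_neqP => /not_orP[/negP/negPn/eqP c0 /negP/negPn/eqP c1].
    by rewrite /Q c0 c1.
  by rewrite finite_setU.
have finQ1 : finite_set [set j | Q (j - 1) != 0].
  exact: finite_set_shift finQ.
split.
  apply: (@sub_finite_set _ _ ([set j | c j != 0] `|`
    ([set j | Q j != 0] `|` [set j | Q (j - 1) != 0]))%classic).
    move=> j /=; rewrite phiE intr_eq0; apply: contra_neqP.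
    move=> /not_orP[/negP/negPn/eqP -> /not_orP[/negP/negPn/eqP -> /negP/negPn/eqP ->]].
    by rewrite mulr0 !subr0.
  by rewrite !finite_setU.
have beta0 : - b%:R != 0 :> C by rewrite oppr_eq0 pnatr_eq0; lia.
(* [H j] is the carry out of position j, with weight beta^(j+1). As beta = - b, the terms
   [- b * Q j] and [- Q (j - 1)] contribute [H j] and [- H (j - 1)] at position j, which cancel
   after a shift. *)
pose H (j : int) : C := (Q j)%:~R * (- b%:R) ^ (j + 1).
have finH : finite_set [set j | H j != 0].
  by apply: sub_finite_set finQ => j /=; apply: contra_neq; rewrite /H => ->; rewrite mul0r.
rewrite /word_value.
under eq_fsbigr => j _.
  have -> : val (phi u j) * (- b%:R) ^ j =
      val (u j) * (- b%:R) ^ j + (H j - H (j - 1)).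
    rewrite phiE uE /H subrK expfzDr // expr1z !rmorphB rmorphM /= -pmulrn.
    by ring.
  over.
have finHN : finite_set [set j | - H (j - 1) != 0].
  under eq_set => j do rewrite oppr_eq0.
  exact: finite_set_shift finH.
rewrite !fsumT_split //.
- rewrite (fsumT_shift (fun j => - H j)) -fsumT_split //.
    rewrite [X in _ + X]fsbig1 ?addr0 // => j _; exact: subrr.
  by under eq_set => j do rewrite oppr_eq0.
- by apply: sub_finite_set finu => j /=; apply: contra_neq => ->; rewrite mul0r.
- apply: (@sub_finite_set _ _ ([set j | H j != 0] `|` [set j | - H (j - 1) != 0])%classic).
    move=> j /=; apply: contra_neqP => /not_orP[/negP/negPn/eqP -> /negP/negPn/eqP ->].
    by rewrite addr0.
  by rewrite finite_setU.
Qed.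

(** * Necessity of b + 1 digits *)

(* The image of the word carrying [x] on [0, r + t] is the image of the word
   carrying [x] on [0, r + t) with one digit, Phi (x, ..., x), inserted at
   position [r]; comparing the values gives the congruence modulo beta - 1. *)
Lemma parallel_addition_congruence (C : numFieldType) (b : nat) (A : {fset C})
    (x : sum_alphabet A) (k : int) :
  (0 < b)%N -> contiguous_integers A -> 0 \in A ->
  allows_parallel_addition (- b%:R : C) A -> val x = k%:~R ->
  exists2 l : int, l%:~R \in A & (b%:Z + 1 %| k - l)%Z.
Proof.
move=> b_gt0 [m [n AE]] A0 [phi [conv [p [r [t [-> [Phi phiE]]]]]]] xE.
have digitE (y : A) : exists l : int, val y = l%:~R.
  by have /AE[l [_ ->]] := valP y; exists l.
have beta0 : - b%:R != 0 :> C by rewrite oppr_eq0 pnatr_eq0; lia.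
have S0 : 0 \in sum_alphabet A.
  by apply/imfset2P; exists 0 => //=; exists 0 => //=; rewrite addr0.
pose u (N : nat) (j : int) : sum_alphabet A :=
  if 0 <= j < N%:Z then x else [` S0]%fset.
have uS N j : val (u N.+1 j) * (- b%:R) ^ j =
    val (u N j) * (- b%:R) ^ j + (if j == N%:Z then val x * (- b%:R) ^ j else 0).
  rewrite /u; have [->|jN] := eqVneq j N%:Z.
    by rewrite ltxx andbF mul0r add0r ifT //; lia.
  by rewrite addr0; congr (val _ * _); congr (if _ then _ else _); lia.
have finu N : finite_word (u N).
  elim: N => [|N IHN].
    apply: sub_finite_set (@finite_set0 int) => j /=; rewrite /u ifF ?eqxx //.
    by lia.
  have : finite_set ([set j | val (u N j) != 0%R] `|` [set N%:Z])%classic.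
    by rewrite finite_setU; split=> //; exact: finite_set1.
  apply: sub_finite_set => j /=; rewrite /u.
  have [->|jN] := eqVneq j N%:Z; first by right.
  by left; have <- : (0 <= j < N.+1%:Z) = (0 <= j < N%:Z) by lia.
have finw (B : {fset C}) (w : int -> B) : finite_word w ->
    finite_set [set j | val (w j) * (- b%:R) ^ j != 0]%classic.
  by apply: sub_finite_set => j /=; apply: contra_neq => ->; rewrite mul0r.
have fin1 (f : int -> C) (i : int) :
    finite_set [set j | (if j == i then f j else 0) != 0]%classic.
  apply: sub_finite_set (finite_set1 i) => j /=.
  by case: (j =P i) => // _; rewrite eqxx.
have sum1 (f : int -> C) (i : int) :
    \sum_(j \in [set: int]) (if j == i then f j else 0) = f i.
  transitivity (\sum_(j \in [set i]%classic) f j); last exact: fsbig_set1.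
  rewrite [RHS]fsbig_mkcond; apply: eq_fsbigr => j _.
  by rewrite /patch in_set1.
(* With this length, windows centred at j < r end before position N, where the two words differ, and
   windows centred at j > r start at 1 or later, where the longer word is the shorter one shifted by
   1. *)
pose N := (r + t)%N.
have valueS : word_value (- b%:R) (u N.+1) =
    word_value (- b%:R) (u N) + val x * (- b%:R) ^ N.
  rewrite /word_value; under eq_fsbigr => j _ do rewrite uS.
  rewrite fsumT_split ?(sum1 (fun j => val x * (- b%:R) ^ j)) //; exact: finw.
pose v := phi (u N); pose v' := phi (u N.+1).
have v'_lt (j : int) : j < r%:Z -> v' j = v j.
  move=> jr; rewrite /v' /v !phiE; congr Phi; apply: eq_from_tnth => i.
  by rewrite !tnth_mktuple /u; congr (if _ then _ else _); rewrite /N; lia.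
have v'_gt (j : int) : r%:Z < j -> v' j = v (j - 1).
  move=> jr; rewrite /v' /v !phiE; congr Phi; apply: eq_from_tnth => i.
  rewrite !tnth_mktuple /u; congr (if _ then _ else _).
  by have := ltn_ord i; rewrite /N; lia.
pose F (j : int) : C := val (v j) * (- b%:R) ^ j.
pose L (j : int) : C := if j < r%:Z then F j else 0.
pose G (j : int) : C := if r%:Z <= j then F j else 0.
have finF : finite_set [set j | F j != 0]%classic.
  exact: finw (conv _ (finu N)).1.
have finL : finite_set [set j | L j != 0]%classic.
  by apply: sub_finite_set finF => j /=; rewrite /L; case: ifP => //; rewrite eqxx.
have finG : finite_set [set j | G j != 0]%classic.
  by apply: sub_finite_set finF => j /=; rewrite /G; case: ifP => //; rewrite eqxx.
have v_value : word_value (- b%:R) v =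
    \sum_(j \in [set: int]) L j + \sum_(j \in [set: int]) G j.
  rewrite -fsumT_split //; apply: eq_fsbigr => j _.
  by rewrite /L /G; case: ltP; rewrite (addr0, add0r).
have v'_value : word_value (- b%:R) v' = \sum_(j \in [set: int]) L j +
    (val (v' r) * (- b%:R) ^ r + - b%:R * \sum_(j \in [set: int]) G j).
  have finG1 : finite_set [set j | - b%:R * G (j - 1) != 0]%classic.
    apply: (@sub_finite_set _ _ [set j | G (j - 1) != 0]%classic).
      by move=> j /=; apply: contra_neq => ->; rewrite mulr0.
    exact: finite_set_shift finG.
  rewrite mulr_fsumr -(fsumT_shift (fun j => - b%:R * G j) (-1)).
  rewrite -(sum1 (fun j : int => val (v' j) * (- b%:R) ^ j) r).
  have fin_r : finite_set
      [set j | (if j == r%:Z then val (v' j) * (- b%:R) ^ j else 0) != 0]%classic.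
    exact: (fin1 (fun j : int => val (v' j) * (- b%:R) ^ j)).
  rewrite -fsumT_split // -fsumT_split //; last first.
    have : finite_set ([set j | (if j == r%:Z then val (v' j) * (- b%:R) ^ j else 0)
        != 0] `|` [set j | - b%:R * G (j - 1) != 0])%classic.
      by rewrite finite_setU.
    apply: sub_finite_set => j /=; apply: contra_neqP.
    by move=> /not_orP[/negP/negPn/eqP -> /negP/negPn/eqP ->]; rewrite addr0.
  apply: eq_fsbigr => j _; rewrite /L /G.
  have [jr|jr|->] := ltgtP j r%:Z.
  - by rewrite v'_lt // ifF ?mulr0 ?addr0 //; lia.
  - rewrite v'_gt // ifT; last by lia.
    by rewrite !add0r /F mulrCA -{2}(expr1z (- b%:R)) -expfzDr // [1 + _]addrC subrK.
  - by rewrite add0r ifF ?mulr0 ?addr0 //; lia.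
(* [G] lives on positions j >= r >= 0, so no negative power of beta occurs. *)
have [s sE] : exists s : int, \sum_(j \in [set: int]) G j = s%:~R.
  apply: fsumT_intr => j; rewrite /G /F; case: ifP => [rj|_]; last by exists 0.
  have [l ->] := digitE (v j); exists (l * (- b%:Z) ^+ `|j|%N).
  by rewrite rmorphM rmorphXn rmorphN /= -pmulrn exprnP gez0_abs //; lia.
have [l lE] := digitE (v' r).
exists l; first by rewrite -lE; exact: valP.
(* Subtract the two values: the sum of [L], possibly not an integer, cancels, and that of [G] is
   multiplied by beta - 1 = - (b + 1). *)
have key : k * (- b%:Z) ^+ N = l * (- b%:Z) ^+ r - (b%:Z + 1) * s.
  apply: (@intr_inj C); move: valueS.
  rewrite -(conv _ (finu N)).2 -(conv _ (finu N.+1)).2 -/v -/v' v_value v'_value.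
  rewrite !(rmorphM, rmorphB, rmorphD, rmorphXn, rmorphN) /= -!pmulrn.
  rewrite sE lE xE -!exprnP => eq_val; apply: (addrI (\sum_(j \in [set: int]) L j + s%:~R)).
  by rewrite -eq_val; ring.
(* Powers of beta are 1 modulo b + 1, so they disappear from [key]. *)
have dvd_pow i : (b%:Z + 1 %| (- b%:Z) ^+ i - 1)%Z.
  by rewrite subrX1 dvdz_mulr //; apply/dvdzP; exists (-1); lia.
have -> : k - l = l * ((- b%:Z) ^+ r - 1) - k * ((- b%:Z) ^+ N - 1)
    - (b%:Z + 1) * s.
  by rewrite !mulrBr key; ring.
apply: rpredB; last exact: dvdz_mulr.
by apply: rpredB; apply: dvdz_mull; exact: dvd_pow.
Qed.

Theorem theorem25 (R : realType) (b : nat) (hb : (2 <= b)%N) :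
  (forall A : {fset R[i]},
     contiguous_integers A -> 0 \in A -> #|` A|%fset = (b + 1)%N ->
     allows_parallel_addition (- b%:R : R[i]) A) /\
  (forall A : {fset R[i]},
     contiguous_integers A -> 0 \in A -> (exists2 x, x \in A & x != 0) ->
     (#|` A|%fset < b + 1)%N ->
     ~ allows_parallel_addition (- b%:R : R[i]) A).
Proof.
split=> [A contA A0 cardA|A contA A0 [x xA x0] cardA addA].
  exact: parallel_addition_exists.
have [m [n AE]] := contA.
have mn0 := contiguous_zeroP AE A0.
have cardE := contiguous_card AE A0.
have nm : n - m < b%:Z by move: cardA; rewrite -ltz_nat cardE; lia.
have not_digit (k : int) : (k = n + 1 \/ k = m - 1) ->
    (k%:~R : R[i]) \notin sum_alphabet A.
  move=> kE; apply/negP => kS.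
  have [||l] := @parallel_addition_congruence _ b A [` kS]%fset k _ contA A0 addA.
  - by lia.
  - by [].
  move=> /AE[l' [l'mn /intr_inj ->]] /dvdzP[c cE].
  (* The distance from [n + 1] or [m - 1] to a digit is between 1 and [n - m + 1 <= b]. *)
  have k_neq : k - l' != 0 by case: kE => ->; lia.
  have : - (b%:Z + 1) < k - l' < b%:Z + 1 by case: kE => ->; lia.
  have [c0|c_lt0|c_gt0] := ltgtP c 0; nia.
have /AE[k [kmn kE]] := xA.
have k0 : k != 0 by move: x0; rewrite kE intr_eq0.
have inS (y z : int) : m <= y <= n -> m <= z <= n ->
    ((y + z)%:~R : R[i]) \in sum_alphabet A.
  move=> y_mn z_mn; apply/imfset2P; exists y%:~R => /=; first by apply/AE; exists y.
  by exists z%:~R; [apply/AE; exists z | rewrite rmorphD].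
(* If [n > 0] then 1 is a digit; otherwise the nonzero digit [k] forces [m < 0], and -1 is a
   digit. *)
have [n_gt0|n_le0] := ltP 0 n.
  have := not_digit (n + 1) (or_introl erefl); rewrite inS //; lia.
have := not_digit (m - 1) (or_intror erefl); rewrite inS //; lia.
Qed.
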